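(* Let $k$ be an algebraically closed field and let $G_{1},\ldots ,G_{n}$ be finitely presented groups. Then there exist a finite, connected quiver $\hat{Q}$ without oriented cycles and admissible ideals $I_{1},\ldots ,I_{n}$ of the path algebra $k\hat{Q}$ such that $k\hat{Q}/I_{1}\cong k\hat{Q}/I_{2}\cong \cdots \cong k\hat{Q}/I_{n}$ (i.e. the $(\hat{Q},I_{i})$ are presentations of one and the same triangular algebra $A$) and $\pi _{1}(\hat{Q},I_{i})\cong G_{i}$ for every $i=1,\ldots ,n$.
   Context: A quiver $Q$ consists of finite sets of vertices $Q_0$ and arrows $Q_1$ with source and target maps; $kQ$ is its path algebra (basis: all paths, including a stationary path $e_x$ for each vertex $x$). Let $F$ be the two-sided ideal of $kQ$ generated by the arrows. A two-sided ideal $I$ of $kQ$ is admissible if $F^{m}\subseteq I\subseteq F^{2}$ for some $m\geq 2$. A presentation of a basic connected finite-dimensional $k$-algebra $A$ is a pair $(Q,I)$ with $I$ admissible and $kQ/I\cong A$. $A$ (or $Q$) is triangular if $Q$ has no oriented cycles. Fundamental group: for vertices $x,y$ let $I(x,y)=e_x(kQ)e_y\cap I$. A relation $\rho=\sum_{i=1}^{m}\lambda_i w_i\in I(x,y)$ (with $\lambda_i\in k^{*}$ and $w_i$ distinct paths from $x$ to $y$) is minimal if $m\geq 2$ and for every proper nonempty subset $J\subset\{1,\ldots,m\}$, $\sum_{i\in J}\lambda_i w_i\notin I(x,y)$. For each arrow $\alpha:x\to y$ let $\alpha^{-1}$ be a formal inverse from $y$ to $x$; a walk is a composable sequence of arrows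 and formal inverses. Homotopy $\sim$ is the smallest equivalence relation on walks such that $\alpha\alpha^{-1}\sim e_x$, $\alpha^{-1}\alpha\sim e_y$ for every arrow $\alpha:x\to y$; $w_i\sim w_j$ for all paths $w_i,w_j$ occurring in a common minimal relation $\sum\lambda_i w_i$ of $I$; and $u\sim v$ implies $wuw'\sim wvw'$ whenever defined. For a vertex $v_0$, $\pi_1(Q,I,v_0)$ is the group of homotopy classes of closed walks at $v_0$ under concatenation; for connected $Q$ it is independent of $v_0$ and denoted $\pi_1(Q,I)$. *)

(* Defs.v *)
From HB Require Import structures.
From mathcomp Require Import all_boot all_order all_algebra.
Set Implicit Arguments. Unset Strict Implicit. Unset Printing Implicit Defensive.
Import GRing.Theory.
Local Open Scope ring_scope.

Record AbsGroup := MkGroup {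
  gcar :> Type;
  gmul : gcar -> gcar -> gcar;
  ginv : gcar -> gcar;
  gone : gcar;
  gmulA : forall x y z, gmul x (gmul y z) = gmul (gmul x y) z;
  gmul1 : forall x, gmul gone x = x;
  gmulV : forall x, gmul (ginv x) x = gone }.

(* A finite presentation < x_0, ..., x_{pgen-1} | prel > ; a word is a list of
   letters (generator, exponent sign), true = x, false = x^-1. *)
Record presentation := MkPresentation {
  pgen : nat;
  prel : seq (seq ('I_pgen * bool)) }.

Definition word (P : presentation) := seq ('I_(pgen P) * bool).

Inductive wequiv (P : presentation) : word P -> word P -> Prop :=
| we_refl u : wequiv u u
| we_sym u v : wequiv u v -> wequiv v u
| we_trans u v w : wequiv u v -> wequiv v w -> wequiv u w
| we_free (g : 'I_(pgen P)) (b : bool) : wequiv [:: (g, b); (g, ~~ b)] [::]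
| we_rel (r : word P) : r \in prel P -> wequiv r [::]
| we_ctx (s u v t : word P) : wequiv u v -> wequiv (s ++ u ++ t) (s ++ v ++ t).

Definition presents (P : presentation) (G : AbsGroup) : Prop :=
  exists phi : word P -> G,
    (forall u v, wequiv u v <-> phi u = phi v) /\
    (forall g : G, exists u, phi u = g) /\
    (forall u v, phi (u ++ v) = gmul (phi u) (phi v)).

Definition finitely_presented (G : AbsGroup) : Prop :=
  exists P : presentation, presents P G.

Record quiver := Quiver {
  nverts : nat;
  narrs : nat;
  src : 'I_narrs -> 'I_nverts;
  tgt : 'I_narrs -> 'I_nverts }.

Section Quiv.
Variable Q : quiver.

(* a path: start vertex and list of arrows, composed left to right *)
Definition qpath := ('I_(nverts Q) * seq 'I_(narrs Q))%type.

Definition qvalid (p : qpath) : bool :=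
  if p.2 is a :: s then (src a == p.1) && path (fun a b => tgt a == src b) a s
  else true.

Definition qend (p : qpath) : 'I_(nverts Q) := last p.1 (map (@tgt Q) p.2).

Definition acyclic : Prop :=
  forall p : qpath, qvalid p -> (0 < size p.2)%N -> qend p != p.1.

Definition qadj : rel 'I_(nverts Q) := fun x y =>
  [exists a : 'I_(narrs Q),
     ((src a == x) && (tgt a == y)) || ((src a == y) && (tgt a == x))].

Definition qconnected : Prop :=
  (0 < nverts Q)%N /\ forall x y, connect qadj x y.

Section Alg.
Variable k : fieldType.

Definition is_kQ (f : qpath -> k) : Prop :=
  (exists s : seq qpath, forall p, f p != 0 -> p \in s) /\
  (forall p, f p != 0 -> qvalid p).

Definition oneQ : qpath -> k := fun p => if p.2 is [::] then 1 else 0.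

Definition mulQ (f g : qpath -> k) : qpath -> k := fun p =>
  if qvalid p then
    \sum_(i < (size p.2).+1)
      f (p.1, take i p.2) * g (qend (p.1, take i p.2), drop i p.2)
  else 0.

Definition is_ideal (I : (qpath -> k) -> Prop) : Prop :=
  (forall f, I f -> is_kQ f) /\
  (forall f g, (forall p, f p = g p) -> I f -> I g) /\
  I (fun _ => 0) /\
  (forall f g, I f -> I g -> I (fun p => f p + g p)) /\
  (forall c f, I f -> I (fun p => c * f p)) /\
  (forall f g, is_kQ g -> I f -> I (mulQ g f) /\ I (mulQ f g)).

Definition Fpow (m : nat) (f : qpath -> k) : Prop :=
  is_kQ f /\ forall p, f p != 0 -> (m <= size p.2)%N.

Definition admissible (I : (qpath -> k) -> Prop) : Prop :=
  is_ideal I /\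
  exists m : nat, (2 <= m)%N /\ (forall f, Fpow m f -> I f) /\
                  (forall f, I f -> Fpow 2 f).

(* k-algebra isomorphism kQ/I ~ kQ/J, given by a k-linear map on
   representatives inducing it *)
Definition alg_iso (I J : (qpath -> k) -> Prop) : Prop :=
  exists phi : (qpath -> k) -> (qpath -> k),
    (forall f, is_kQ f -> is_kQ (phi f)) /\
    (forall f g, is_kQ f -> is_kQ g ->
       forall p, phi (fun q => f q + g q) p = phi f p + phi g p) /\
    (forall c f, is_kQ f -> forall p, phi (fun q => c * f q) p = c * phi f p) /\
    (forall f, is_kQ f -> (J (phi f) <-> I f)) /\
    (forall f g, is_kQ f -> is_kQ g ->
       J (fun p => phi (mulQ f g) p - mulQ (phi f) (phi g) p)) /\
    J (fun p => phi oneQ p - oneQ p) /\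
    (forall g, is_kQ g -> exists f, is_kQ f /\ J (fun p => phi f p - g p)).

Definition minimal_rel (I : (qpath -> k) -> Prop) (f : qpath -> k) : Prop :=
  I f /\
  (exists x y, forall p, f p != 0 -> p.1 = x /\ qend p = y) /\
  (exists p q, p <> q /\ f p != 0 /\ f q != 0) /\
  (forall P : pred qpath,
     (exists p, f p != 0 /\ P p) -> (exists p, f p != 0 /\ ~~ P p) ->
     ~ I (fun p => if P p then f p else 0)).

(* walks: letters (a, true) = a, (a, false) = a^-1 *)
Definition letter := ('I_(narrs Q) * bool)%type.
Definition walk := ('I_(nverts Q) * seq letter)%type.

Definition lsrc (l : letter) := if l.2 then src l.1 else tgt l.1.
Definition ltgt (l : letter) := if l.2 then tgt l.1 else src l.1.

Definition wvalid (w : walk) : bool :=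
  if w.2 is l :: s then (lsrc l == w.1) && path (fun l1 l2 => ltgt l1 == lsrc l2) l s
  else true.

Definition wend (w : walk) : 'I_(nverts Q) := last w.1 (map ltgt w.2).

Definition path_walk (p : qpath) : walk := (p.1, map (fun a => (a, true)) p.2).

Inductive homot (I : (qpath -> k) -> Prop) : walk -> walk -> Prop :=
| h_refl w : homot I w w
| h_sym w1 w2 : homot I w1 w2 -> homot I w2 w1
| h_trans w1 w2 w3 : homot I w1 w2 -> homot I w2 w3 -> homot I w1 w3
| h_can1 (a : 'I_(narrs Q)) : homot I (src a, [:: (a, true); (a, false)]) (src a, [::])
| h_can2 (a : 'I_(narrs Q)) : homot I (tgt a, [:: (a, false); (a, true)]) (tgt a, [::])
| h_rel (f : qpath -> k) (p q : qpath) :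
    minimal_rel I f -> f p != 0 -> f q != 0 -> homot I (path_walk p) (path_walk q)
| h_ctx (w u v w' : walk) :
    homot I u v -> wvalid w -> wvalid u -> wvalid v -> wvalid w' ->
    wend w = u.1 -> wend w = v.1 -> wend u = w'.1 -> wend v = w'.1 ->
    homot I (w.1, w.2 ++ u.2 ++ w'.2) (w.1, w.2 ++ v.2 ++ w'.2).

Definition closed_at (v0 : 'I_(nverts Q)) (w : walk) : bool :=
  [&& wvalid w, w.1 == v0 & wend w == v0].

Definition pi1_iso (I : (qpath -> k) -> Prop) (v0 : 'I_(nverts Q)) (G : AbsGroup) : Prop :=
  exists phi : walk -> G,
    (forall w1 w2, closed_at v0 w1 -> closed_at v0 w2 ->
       (homot I w1 w2 <-> phi w1 = phi w2)) /\
    (forall g : G, exists w, closed_at v0 w /\ phi w = g) /\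
    (forall w1 w2, closed_at v0 w1 -> closed_at v0 w2 ->
       phi (v0, w1.2 ++ w2.2) = gmul (phi w1) (phi w2)).

End Alg.
End Quiv.

(* Main.v *)
(* Finitely many finitely presented groups have presentations over one finite
   set of generators, containing a symbol e for the unit, whose relators are e
   and words x y z^-1; let T_i be the set of triples (x, y, z) occurring for G_i.
   The quiver has vertices v0, v1, v2, arrows x_0 : v0 -> v1 and x_1 : v1 -> v2
   for each generator x and, for each triple t = (x, y, z), an arrow
   a_t : v0 -> v2 and an arrow d_t from v2 to a new sink. The ideal I_i is
   spanned by the elements (a_t - c q_(i,t) - z_0 e_1) d_t, where q_(i,t) is
   x_0 y_1 if t is in T_i and z_0 e_1 otherwise. These elements are combinations
   of maximal paths from the source v0 to distinct sinks, so their span is an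
   ideal and its minimal relations are their nonzero multiples. Hence a_t is
   homotopic to z_0 e_1, which is homotopic to x_0 y_1 when t is in T_i, and the
   spanning tree made of e_0, e_1 and the d_t identifies pi_1 with G_i.
   The automorphism a_t |-> a_t + c (q_(i,t) - q_(j,t)) of kQ maps I_i onto I_j.
   The scalar c is a root of c^2 + c + 1, so that neither c nor 1 + c vanishes:
   the coefficient -(1 + c) occurs when q_(i,t) = z_0 e_1. *)
Require Import Defs.
From mathcomp Require Import all_boot all_order all_algebra.
Set Implicit Arguments. Unset Strict Implicit. Unset Printing Implicit Defensive.

(** * Formal inverses of words and of walks *)

Definition winv (A : Type) (u : seq (A * bool)) := rev [seq (l.1, ~~ l.2) | l <- u].

Lemma winv_cat (A : Type) (u v : seq (A * bool)) :
  winv (u ++ v) = winv v ++ winv u.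
Proof. by rewrite /winv map_cat rev_cat. Qed.

Lemma winv_cons (A : Type) (l : A * bool) u :
  winv (l :: u) = winv u ++ [:: (l.1, ~~ l.2)].
Proof. by rewrite -cat1s winv_cat. Qed.

Lemma winvK (A : Type) : involutive (@winv A).
Proof.
move=> u; rewrite /winv map_rev revK -map_comp -[RHS]map_id.
by apply: eq_map => -[g b] /=; rewrite negbK.
Qed.

Section Words.
Variable P : presentation.
Implicit Types u v : word P.

Lemma wequiv_cat u u' v v' :
  wequiv u u' -> wequiv v v' -> wequiv (u ++ v) (u' ++ v').
Proof.
move=> Hu Hv; apply: (we_trans (v := u' ++ v)).
  by have := we_ctx [::] v Hu.
by have := we_ctx u' [::] Hv; rewrite !cats0.
Qed.

Lemma wequiv_winvr u : wequiv (u ++ winv u) [::].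
Proof.
elim: u => [|l u IH]; first exact: we_refl.
rewrite winv_cons -cat1s -catA (catA u).
apply: (we_trans (we_ctx [:: l] [:: (l.1, ~~ l.2)] IH)) => /=.
by case: l => g b; apply: we_free.
Qed.

Lemma wequiv_winvl u : wequiv (winv u ++ u) [::].
Proof. by have := wequiv_winvr (winv u); rewrite winvK. Qed.

Lemma wequiv_cancelr u v w : wequiv (u ++ w) (v ++ w) -> wequiv u v.
Proof.
move=> H; have K x : wequiv ((x ++ w) ++ winv w) x.
  rewrite -catA -[X in wequiv _ X]cats0.
  exact: wequiv_cat (we_refl _) (wequiv_winvr _).
apply: we_trans (we_sym (K u)) (we_trans _ (K v)).
exact: wequiv_cat H (we_refl _).
Qed.

Lemma wequiv_winv u v : wequiv u v -> wequiv (winv u) (winv v).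
Proof.
move=> H; apply: (@wequiv_cancelr _ _ u).
apply: we_trans (wequiv_winvl u) (we_sym _).
apply: we_trans (wequiv_winvl v).
exact: wequiv_cat (we_refl _) H.
Qed.

End Words.

(** * Presentations given by a partial multiplication table *)

Section TablePresentation.
Variables (m : nat) (e : 'I_m) (T : 'I_m -> 'I_m -> 'I_m -> bool).

Definition table_presentation := @MkPresentation m
  ([:: (e, true)] ::
   [seq [:: (t.1.1, true); (t.1.2, true); (t.2, false)]
      | t <- enum {: 'I_m * 'I_m * 'I_m} & T t.1.1 t.1.2 t.2]).

Local Notation TP := table_presentation.

Lemma table_unit : @wequiv TP [:: (e, true)] [::].
Proof. by apply: we_rel; rewrite inE eqxx. Qed.

Lemma table_rel x y z : T x y z ->
  @wequiv TP [:: (x, true); (y, true)] [:: (z, true)].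
Proof.
move=> Txyz; apply: (@wequiv_cancelr TP _ _ [:: (z, false)]) => /=.
apply: we_trans (we_sym (@we_free TP z true)).
apply: we_rel; rewrite inE; apply/orP; right.
by apply/mapP; exists (x, y, z); rewrite // mem_filter mem_enum /= Txyz.
Qed.

Lemma table_mulr1 x : @wequiv TP [:: (x, true); (e, true)] [:: (x, true)].
Proof. exact: (@wequiv_cat TP [:: (x, true)] _ _ _ (we_refl _) table_unit). Qed.

(** The triple reads x e = e. In this way an arbitrary relator, coded as a single generator, fits
    the format x y = z. *)
Lemma table_killed x : T x e e -> @wequiv TP [:: (x, true)] [::].
Proof.
move=> Tx; apply: we_trans (we_sym (table_mulr1 x)) _.
exact: we_trans (table_rel Tx) table_unit.
Qed.

Lemma table_ind (Rel : word TP -> Prop) :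
  Rel [:: (e, true)] ->
  (forall x y z, T x y z -> Rel [:: (x, true); (y, true); (z, false)]) ->
  forall r, r \in prel TP -> Rel r.
Proof.
move=> R1 RT r; rewrite inE => /orP[/eqP-> //|/mapP[[[x y] z]]].
by rewrite mem_filter /= => /andP[Txyz _] ->; apply: RT.
Qed.

End TablePresentation.

(** * Passing to a table whose generators are the words of bounded length *)

Section BoundedWords.
Variables (N L : nat).
Local Notation A := ('I_N * bool)%type.
Local Notation m := #|{: L.-bseq A}|.

(** Each word of length at most [L] over the common alphabet becomes one generator; longer words
    only get a default code. *)
Definition word_code (s : seq A) : 'I_m := enum_rank (insub_bseq L s).
Definition word_decode (x : 'I_m) : seq A := enum_val x : L.-bseq A.

Lemma word_codeK s : size s <= L -> word_decode (word_code s) = s.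
Proof.
by move=> sL; rewrite /word_decode /word_code enum_rankK /insub_bseq insubdK.
Qed.

Variable P : presentation.
Hypothesis le_pgen : pgen P <= N.
Hypothesis L_gt1 : 1 < L.
Hypothesis rel_size : forall r, r \in prel P -> size r <= L.

(** Letters of the common alphabet that are not generators of [P] are discarded, hence stand for the
    unit; so presentations with different numbers of generators can share one alphabet. *)
Definition restr_letter (l : A) : option ('I_(pgen P) * bool) :=
  omap (fun g => (g, l.2)) (insub (val l.1)).
Definition restr (s : seq A) : word P := pmap restr_letter s.
Definition widen_letter (l : 'I_(pgen P) * bool) : A := (widen_ord le_pgen l.1, l.2).

Lemma widen_letterK : pcancel widen_letter restr_letter.
Proof. by case=> g b; rewrite /restr_letter /= valK. Qed.

Lemma restr_letter_widen l l0 : restr_letter l = Some l0 -> l = widen_letter l0.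
Proof.
rewrite /restr_letter; case: l => g b /=; case: insubP => //= h _ hE [<-].
by congr (_, _); apply: val_inj; rewrite /= -hE.
Qed.

(** A decidable family of words equal to 1, just large enough to contain the relators, the free
    cancellations and, through the empty word, the restrictions of foreign letters. *)
Definition trivial_word (u : word P) : bool :=
  [|| u == [::], u \in prel P |
      if u is [:: l; l'] then (l' == (l.1, ~~ l.2)) else false].

Lemma trivial_wordP u : trivial_word u -> wequiv u [::].
Proof.
case/or3P=> [/eqP->|/we_rel //|]; first exact: we_refl.
by case: u => [|[g b] [|l' [|]]] //= /eqP->; apply: we_free.
Qed.

(** The first alternative makes generators multiply as the words they code; the second, a triple (x,
    e, e), kills the code of a trivial word. *)
Definition word_table (x y z : 'I_m) : bool :=
  (word_decode z == word_decode x ++ word_decode y) ||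
  [&& word_decode y == [::], word_decode z == [::] &
      trivial_word (restr (word_decode x))].

Local Notation e := (word_code [::]).
Local Notation TP := (table_presentation e word_table).

Lemma word_table_unit z : word_table e z z.
Proof. by rewrite /word_table word_codeK // eqxx. Qed.

Definition to_table (u : word P) : word TP :=
  [seq (word_code [:: widen_letter l], true) | l <- u].

Definition of_table_letter (l : 'I_m * bool) : word P :=
  let u := restr (word_decode l.1) in if l.2 then u else winv u.
Definition of_table (u : word TP) : word P := flatten (map of_table_letter u).

Lemma of_table_cat u v : of_table (u ++ v) = of_table u ++ of_table v.
Proof. by rewrite /of_table map_cat flatten_cat. Qed.

Lemma of_tableK : cancel to_table of_table.
Proof.
elim=> [|l u IH] //=; rewrite /of_table /= -/(of_table _) IH.
rewrite /of_table_letter /= word_codeK ?(ltnW L_gt1) //.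
by rewrite /restr /= widen_letterK.
Qed.

Lemma table_trivial s : size s <= L -> trivial_word (restr s) ->
  @wequiv TP [:: (word_code s, true)] [::].
Proof.
move=> sL ts; apply: table_killed.
by rewrite /word_table !word_codeK // eqxx ts orbT.
Qed.

Lemma table_cat s t : size (s ++ t) <= L ->
  @wequiv TP [:: (word_code s, true); (word_code t, true)]
             [:: (word_code (s ++ t), true)].
Proof.
move=> stL; apply: table_rel; rewrite /word_table !word_codeK ?eqxx //.
  by apply: leq_trans stL; rewrite size_cat leq_addl.
by apply: leq_trans stL; rewrite size_cat leq_addr.
Qed.

(** A code is assembled letter by letter from one-letter codes, every suffix still having length at
    most [L]; the code of a letter foreign to [P] is trivial in the table group. *)
Lemma to_table_restr s : size s <= L ->
  wequiv (to_table (restr s)) [:: (word_code s, true)].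
Proof.
elim: s => [_|l s IH sL]; first by apply: we_sym; apply: table_unit.
have {}IH := IH (ltnW sL).
apply: we_trans (@table_cat [:: l] s sL).
have L1 := ltnW L_gt1.
rewrite /restr /= -/(restr s); case E: (restr_letter l) => [l0|] /=.
  rewrite -(restr_letter_widen E).
  exact: (@wequiv_cat TP [:: _] _ _ _ (we_refl _) IH).
apply: (@wequiv_cat TP [::] [:: _] _ _ _ IH).
by apply/we_sym/table_trivial; rewrite // /restr /= E.
Qed.

Lemma to_table_trivial (u : word P) : size u <= L -> trivial_word u ->
  wequiv (to_table u) [::].
Proof.
move=> uL tu; have rE : restr (map widen_letter u) = u.
  exact: map_pK widen_letterK u.
rewrite -{1}rE; apply: we_trans (to_table_restr _) (table_trivial _ _);
  by rewrite ?size_map ?rE.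
Qed.

Lemma to_table_equiv u v : wequiv u v -> wequiv (to_table u) (to_table v).
Proof.
elim=> {u v}.
- by move=> u; apply: we_refl.
- by move=> u v _; apply: we_sym.
- by move=> u v w _ uv _; apply: we_trans.
- by move=> g b; apply: to_table_trivial => //; rewrite /trivial_word /= eqxx orbT.
- by move=> r Pr; apply: to_table_trivial; rewrite ?rel_size // /trivial_word Pr orbT.
move=> s u v t _ uv; rewrite /to_table !map_cat; exact: (@we_ctx TP).
Qed.

Lemma to_tableK u : wequiv (to_table (of_table u)) u.
Proof.
have to_cat (v w : word P) : to_table (v ++ w) = to_table v ++ to_table w.
  exact: map_cat.
elim: u => [|l u IH]; first exact: we_refl.
rewrite -cat1s of_table_cat to_cat.
apply: wequiv_cat IH; rewrite /of_table /= cats0.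
have code x : wequiv (to_table (restr (word_decode x))) [:: (x, true)].
  have := @to_table_restr (word_decode x) (size_bseq _).
  suff -> : word_code (word_decode x) = x by [].
  apply: (can_inj (@enum_valK _)).
  by rewrite /word_code enum_rankK; apply/val_inj/insubdK/size_bseq.
case: l => x [] /=; rewrite /of_table_letter /=; first exact: code.
(* For an inverse letter, both sides are multiplied by the word of the letter itself, whose code is
   already known. *)
apply: (@wequiv_cancelr TP _ _ (to_table (restr (word_decode x)))).
rewrite -to_cat; apply: we_trans (to_table_equiv (wequiv_winvl _)) (we_sym _).
apply: we_trans (wequiv_cat (we_refl _) (code x)) _.
exact: (@we_free TP x false).
Qed.

Lemma of_table_equiv u v : wequiv u v -> wequiv (of_table u) (of_table v).
Proof.
elim=> {u v}.
- by move=> u; apply: we_refl.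
- by move=> u v _; apply: we_sym.
- by move=> u v w _ uv _; apply: we_trans.
- move=> x [] /=; rewrite /of_table /= cats0 /of_table_letter /=.
    exact: wequiv_winvr.
  exact: wequiv_winvl.
- apply: table_ind => [|x y z].
    by rewrite /of_table /= /of_table_letter /= word_codeK //; apply: we_refl.
  rewrite /of_table /= /of_table_letter /= cats0 catA.
  have restr_cat s t : restr (s ++ t) = restr s ++ restr t by apply: pmap_cat.
  case/orP=> [/eqP ->|/and3P[/eqP-> /eqP-> tx]].
    by rewrite -restr_cat; apply: wequiv_winvr.
  by rewrite /= !cats0; apply: trivial_wordP.
by move=> s u v t _ uv; rewrite !of_table_cat; apply: we_ctx.
Qed.

(** [to_table] and [of_table] respect equivalence and are mutually inverse up to it, so both
    presentations define the same group. *)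
Lemma presents_table (G : AbsGroup) : presents P G -> presents TP G.
Proof.
case=> phi [phiE [phi_onto phiM]]; exists (phi \o of_table); split.
  move=> u v /=; split=> [uv|/phiE uv]; first exact/phiE/of_table_equiv.
  apply: we_trans (we_sym (to_tableK u)) (we_trans _ (to_tableK v)).
  exact: to_table_equiv.
split=> [g|u v] /=; last by rewrite of_table_cat phiM.
by have [u <-] := phi_onto g; exists (to_table u); rewrite /= of_tableK.
Qed.

End BoundedWords.

Lemma common_table (n : nat) (G : 'I_n -> AbsGroup) :
  (forall i, finitely_presented (G i)) ->
  exists (m : nat) (e : 'I_m) (T : 'I_n -> 'I_m -> 'I_m -> 'I_m -> bool),
    (forall i z, T i e z z) /\
    (forall i, presents (table_presentation e (T i)) (G i)).
Proof.
case/fin_all_exists=> P presP.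
pose N := \max_i pgen (P i).
(* The bound must admit every relator of every presentation, and also the words of length 2 that
   express free cancellation. *)
pose L := maxn 2 (\max_i \max_(r <- prel (P i)) size r).
exists #|{: L.-bseq ('I_N * bool)}|, (word_code L [::]).
exists (fun i => @word_table N L (P i)); split=> i => [z|].
  exact: word_table_unit.
apply: presents_table (presP i); rewrite ?leq_maxl //.
  exact: leq_bigmax.
move=> r Pr; apply: leq_trans (leq_maxr _ _).
apply: leq_trans (leq_bigmax i).
by rewrite (big_rem r Pr) leq_maxl.
Qed.

(** * Homotopy of walks *)

Section Walks.
Variables (Q : quiver) (k : fieldType) (I : (qpath Q -> k) -> Prop).
Implicit Types (x y z : 'I_(nverts Q)) (s t : seq (letter Q)).

Lemma wvalid_cons x l s :
  wvalid (x, l :: s) = (lsrc l == x) && wvalid (ltgt l, s).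
Proof. by case: s => [|l' s] //=; congr (_ && (_ && _)); apply: eq_sym. Qed.

Definition walk_between x y s := wvalid (x, s) && (wend (x, s) == y).

Lemma walk_nil x y : walk_between x y [::] = (x == y).
Proof. by []. Qed.

Lemma walk_cons x y l s :
  walk_between x y (l :: s) = (lsrc l == x) && walk_between (ltgt l) y s.
Proof. by rewrite /walk_between wvalid_cons andbA. Qed.

Lemma walk_cat x y z s t :
  walk_between x y s -> walk_between y z t -> walk_between x z (s ++ t).
Proof.
elim: s x => [|l s IH] x; first by rewrite walk_nil => /eqP->.
by rewrite cat_cons !walk_cons => /andP[-> /IH].
Qed.

Lemma walk_winv x y s : walk_between x y s -> walk_between y x (winv s).
Proof.
elim: s x => [|l s IH] x; first by rewrite !walk_nil eq_sym.
rewrite walk_cons winv_cons => /andP[/eqP<- /IH sl]; apply: walk_cat sl _.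
by case: l => a []; rewrite walk_cons walk_nil /lsrc /ltgt /= !eqxx.
Qed.

(** [homot] also relates ill-formed walks, for instance by reflexivity, whereas its context rule
    asks for validity; endpoints and validity are therefore carried along. *)
Definition homotopic x y s t :=
  [/\ walk_between x y s, walk_between x y t & homot I (x, s) (x, t)].

Lemma homotopic_refl x y s : walk_between x y s -> homotopic x y s s.
Proof. by split=> //; apply: h_refl. Qed.

Lemma homotopic_sym x y s t : homotopic x y s t -> homotopic x y t s.
Proof. by case=> s_ok t_ok st; split=> //; apply: h_sym. Qed.

Lemma homotopic_trans x y t s u :
  homotopic x y s t -> homotopic x y t u -> homotopic x y s u.
Proof. by case=> s_ok _ st [_ u_ok tu]; split=> //; apply: h_trans st tu. Qed.

Lemma homotopic_cat x y z s s' t t' :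
  homotopic x y s s' -> homotopic y z t t' -> homotopic x z (s ++ t) (s' ++ t').
Proof.
case=> s_ok s'_ok ss' [t_ok t'_ok tt']; split;
  [exact: walk_cat s_ok t_ok | exact: walk_cat s'_ok t'_ok | ].
apply: (h_trans (w2 := (x, s' ++ t))).
  move: s_ok s'_ok t_ok => /andP[sv /eqP se] /andP[sv' /eqP se'] /andP[tv _].
  by have := @h_ctx Q k I (x, [::]) _ _ (y, t) ss'; apply.
move: s'_ok t_ok t'_ok => /andP[sv /eqP se] /andP[tv /eqP te] /andP[tv' /eqP te'].
have := @h_ctx Q k I (x, s') _ _ (z, [::]) tt'; rewrite /= !cats0; exact.
Qed.

Lemma homotopic_catl x y z s t t' : walk_between x y s ->
  homotopic y z t t' -> homotopic x z (s ++ t) (s ++ t').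
Proof. by move/homotopic_refl; apply: homotopic_cat. Qed.

Lemma homotopic_catr x y z s s' t : walk_between y z t ->
  homotopic x y s s' -> homotopic x z (s ++ t) (s' ++ t).
Proof. by move=> /homotopic_refl tt ss; apply: homotopic_cat ss tt. Qed.

Lemma homotopic_winvr x y s : walk_between x y s -> homotopic x x (s ++ winv s) [::].
Proof.
elim: s x => [|l s IH] x; first by move=> _; apply: homotopic_refl; rewrite walk_nil.
rewrite walk_cons => /andP[/eqP <- /IH ss].
rewrite winv_cons -cat1s -catA (catA s).
have lw : walk_between (lsrc l) (ltgt l) [:: l] by rewrite walk_cons walk_nil !eqxx.
have liw := walk_winv lw.
apply: (homotopic_trans (homotopic_catl lw (homotopic_catr liw ss))).
split; [exact: walk_cat lw liw | by rewrite walk_nil | ].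
by case: (l) => a [] /=; [apply: h_can1 | apply: h_can2].
Qed.

Lemma homotopic_winvl x y s : walk_between x y s -> homotopic y y (winv s ++ s) [::].
Proof. by move/walk_winv/homotopic_winvr; rewrite winvK. Qed.

(** This is what removes the common last arrow [out t] from the paths of a relation. *)
Lemma homotopic_cancelr x y z s t u : walk_between y z u ->
  walk_between x y s -> walk_between x y t ->
  homotopic x z (s ++ u) (t ++ u) -> homotopic x y s t.
Proof.
move=> u_ok s_ok t_ok st.
have K r : walk_between x y r -> homotopic x y ((r ++ u) ++ winv u) r.
  move=> r_ok; rewrite -catA -[X in homotopic _ _ _ X]cats0.
  exact: homotopic_catl r_ok (homotopic_winvr u_ok).
apply: homotopic_trans (homotopic_sym (K _ s_ok)) (homotopic_trans _ (K _ t_ok)).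
exact: homotopic_catr (walk_winv u_ok) st.
Qed.

Lemma homotopic_winv x y s t : homotopic x y s t -> homotopic y x (winv s) (winv t).
Proof.
move=> st; have [s_ok t_ok _] := st.
apply: (homotopic_cancelr s_ok (walk_winv s_ok) (walk_winv t_ok)).
apply: homotopic_trans (homotopic_winvl s_ok) (homotopic_sym _).
apply: homotopic_trans (homotopic_winvl t_ok).
exact: homotopic_catl (walk_winv t_ok) st.
Qed.

End Walks.

(** * Paths in a quiver *)

Section Paths.
Variable Q : quiver.

Lemma qvalid_cons v (a : 'I_(narrs Q)) s :
  qvalid (v, a :: s) = (src a == v) && qvalid (tgt a, s).
Proof. by case: s => [|b s] //=; congr (_ && (_ && _)); apply: eq_sym. Qed.

Lemma qend_cons v (a : 'I_(narrs Q)) s : qend (v, a :: s) = qend (tgt a, s).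
Proof. by []. Qed.

Lemma qvalid_cat v (s t : seq 'I_(narrs Q)) :
  qvalid (v, s ++ t) = qvalid (v, s) && qvalid (qend (v, s), t).
Proof.
by elim: s v => [|a s IH] v //; rewrite cat_cons !qvalid_cons IH andbA.
Qed.

End Paths.

Import GRing.Theory.
Local Open Scope ring_scope.

(** * The quiver and its ideals *)

Section Gadget.
Variable m : nat.
Local Notation triple := ('I_m * 'I_m * 'I_m)%type.
Local Notation vert := ('I_3 + triple)%type.
Local Notation arr := ('I_m + 'I_m + triple + triple)%type.

Definition vert_src (a : arr) : vert :=
  match a with
  | inl (inl (inl _)) => inl (inord 0)
  | inl (inl (inr _)) => inl (inord 1)
  | inl (inr _) => inl (inord 0)
  | inr _ => inl (inord 2)
  end.

Definition vert_tgt (a : arr) : vert :=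
  match a with
  | inl (inl (inl _)) => inl (inord 1)
  | inl (inl (inr _)) => inl (inord 2)
  | inl (inr _) => inl (inord 2)
  | inr t => inr t
  end.

Definition gadget_quiver : quiver :=
  @Quiver #|{: vert}| #|{: arr}| (fun a => enum_rank (vert_src (enum_val a)))
    (fun a => enum_rank (vert_tgt (enum_val a))).
Local Notation Q := gadget_quiver.

Definition level (j : 'I_3) : 'I_(nverts Q) := enum_rank (inl j : vert).
Definition leaf (t : triple) : 'I_(nverts Q) := enum_rank (inr t : vert).
Local Notation v0 := (level (inord 0)).
Local Notation v1 := (level (inord 1)).
Local Notation v2 := (level (inord 2)).

Lemma vertex_ind (R : 'I_(nverts Q) -> Prop) :
  R v0 -> R v1 -> R v2 -> (forall t, R (leaf t)) -> forall v, R v.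
Proof.
move=> R0 R1 R2 Rl v; have ordE j (lt : (j < 3)%N) : Ordinal lt = inord j.
  by apply: val_inj; rewrite /= inordK.
by rewrite -[v]enum_valK; case: (enum_val v : vert) => [[[|[|[|//]]] lt]|t];
  rewrite ?ordE; [exact: R0 | exact: R1 | exact: R2 | exact: Rl].
Qed.

(* In the notation of the header: [low x] is x_0, [up x] is x_1, [diag t] is a_t
   and [out t] is d_t. *)
Definition low x : 'I_(narrs Q) := enum_rank (inl (inl (inl x)) : arr).
Definition up x : 'I_(narrs Q) := enum_rank (inl (inl (inr x)) : arr).
Definition diag t : 'I_(narrs Q) := enum_rank (inl (inr t) : arr).
Definition out t : 'I_(narrs Q) := enum_rank (inr t : arr).

Variant arrow_spec : 'I_(narrs Q) -> Type :=
| ArrowLow x : arrow_spec (low x)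
| ArrowUp x : arrow_spec (up x)
| ArrowDiag t : arrow_spec (diag t)
| ArrowOut t : arrow_spec (out t).

Lemma arrowP a : arrow_spec a.
Proof.
by rewrite -[a]enum_valK; case: (enum_val a) => [[[x|x]|t]|t]; constructor.
Qed.

Lemma src_low x : src (low x) = v0. Proof. by rewrite /= enum_rankK. Qed.
Lemma tgt_low x : tgt (low x) = v1. Proof. by rewrite /= enum_rankK. Qed.
Lemma src_up x : src (up x) = v1. Proof. by rewrite /= enum_rankK. Qed.
Lemma tgt_up x : tgt (up x) = v2. Proof. by rewrite /= enum_rankK. Qed.
Lemma src_diag t : src (diag t) = v0. Proof. by rewrite /= enum_rankK. Qed.
Lemma tgt_diag t : tgt (diag t) = v2. Proof. by rewrite /= enum_rankK. Qed.
Lemma src_out t : src (out t) = v2. Proof. by rewrite /= enum_rankK. Qed.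
Lemma tgt_out t : tgt (out t) = leaf t. Proof. by rewrite /= enum_rankK. Qed.
Definition endsE := (src_low, tgt_low, src_up, tgt_up, src_diag, tgt_diag, src_out, tgt_out).

Lemma eq_diag t u : (diag t == diag u) = (t == u).
Proof. exact: (inj_eq enum_rank_inj). Qed.
Lemma eq_out t u : (out t == out u) = (t == u).
Proof. exact: (inj_eq enum_rank_inj). Qed.
Lemma eq_diag_low t x : (diag t == low x) = false.
Proof. exact: (inj_eq enum_rank_inj). Qed.

(** A height that every arrow raises, with the sinks at the top value 3; it excludes cycles and
    bounds the length of paths by 3. *)
Definition vrank (v : 'I_(nverts Q)) : nat :=
  match enum_val v : vert with inl j => j | inr _ => 3 end.

Lemma vrank_level j : vrank (level j) = j.
Proof. by rewrite /vrank /level enum_rankK. Qed.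
Lemma vrank_leaf t : vrank (leaf t) = 3.
Proof. by rewrite /vrank /leaf enum_rankK. Qed.

Lemma vrank_le v : (vrank v <= 3)%N.
Proof. by rewrite /vrank; case: (enum_val _) => // j; apply: ltnW. Qed.

Lemma vrank_arrow a : (vrank (src a) < vrank (tgt a))%N.
Proof. by case/arrowP: a => [x|x|t|t]; rewrite !endsE ?vrank_leaf ?vrank_level ?inordK. Qed.

Lemma vrank_path v (s : seq 'I_(narrs Q)) : qvalid (v, s) ->
  (vrank v + size s <= vrank (qend (v, s)))%N.
Proof.
elim: s v => [|a s IH] v; first by rewrite addn0.
rewrite qvalid_cons => /andP[/eqP<- /IH]; apply: leq_trans.
by rewrite addnS -addSn leq_add2r vrank_arrow.
Qed.

Lemma gadget_acyclic : acyclic Q.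
Proof.
move=> [v s] /vrank_path /= le s_gt0; apply: contraTneq le => ->.
by rewrite -ltnNge -[X in (X < _)%N]addn0 ltn_add2l.
Qed.

Lemma size_path v (s : seq 'I_(narrs Q)) : qvalid (v, s) -> (size s <= 3)%N.
Proof.
move/vrank_path => le; apply: leq_trans (leq_trans le (vrank_le _)).
exact: leq_addl.
Qed.

Lemma gadget_connected : 'I_m -> qconnected Q.
Proof.
move=> e; split; first exact: leq_ltn_trans (leq0n _) (ltn_ord v0).
have sym : connect_sym (@qadj Q).
  by apply: sym_connect_sym => x y; apply: eq_existsb => a; rewrite orbC.
have step a : connect (@qadj Q) (src a) (tgt a).
  by apply/connect1/existsP; exists a; rewrite !eqxx.
have all v : connect (@qadj Q) v0 v.
  have c1 : connect (@qadj Q) v0 v1 by have := step (low e); rewrite !endsE.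
  have c2 : connect (@qadj Q) v0 v2.
    by apply: connect_trans c1 _; have := step (up e); rewrite !endsE.
  elim/vertex_ind: v => [|||t]; [exact: connect0 | exact: c1 | exact: c2 | ].
  by apply: connect_trans c2 _; have := step (out t); rewrite !endsE.
by move=> x y; apply: connect_trans (all y); rewrite sym.
Qed.

(** * The span of the relations as an admissible ideal *)

Section Ideal.
Variables (k : fieldType) (c : k).
Hypotheses (c_neq0 : c != 0) (c_neqN1 : 1 + c != 0).
Variable e : 'I_m.

(** Finite support is automatic, because valid paths have length at most 3 and so are finitely
    many. *)
Lemma is_kQE (f : qpath Q -> k) : is_kQ f <-> forall p, f p != 0 -> qvalid p.
Proof.
split=> [[] //|f_valid]; split=> //.
exists [seq (x.1, val x.2) | x : 'I_(nverts Q) * 3.-bseq 'I_(narrs Q)] => -[v s] /f_valid.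
by move/size_path => s3; apply/imageP; exists (v, Bseq s3).
Qed.

Definition diag_path t : qpath Q := (v0, [:: diag t; out t]).
Definition level_path (q : 'I_m * 'I_m) t : qpath Q :=
  (v0, [:: low q.1; up q.2; out t]).

Implicit Types q : triple -> 'I_m * 'I_m.

Definition gadget_rel q t : qpath Q -> k := fun p =>
  (p == diag_path t)%:R - c * (p == level_path (q t) t)%:R
  - (p == level_path (t.2, e) t)%:R.

Definition gadget_ideal q (f : qpath Q -> k) : Prop :=
  exists C : triple -> k, forall p, f p = \sum_t C t * gadget_rel q t p.

Variant support_spec q t : qpath Q -> Type :=
| SupportDiag : support_spec q t (diag_path t)
| SupportRel : support_spec q t (level_path (q t) t)
| SupportBase : support_spec q t (level_path (t.2, e) t).

Lemma gadget_rel_support q t p : gadget_rel q t p != 0 -> support_spec q t p.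
Proof.
rewrite /gadget_rel; case: (p =P diag_path t) => [-> _|_]; first by constructor.
case: (p =P level_path (q t) t) => [-> _|_]; first by constructor.
case: (p =P level_path (t.2, e) t) => [-> _|_]; first by constructor.
by rewrite mulr0 !subr0 eqxx.
Qed.

Lemma gadget_rel_diag q t u : gadget_rel q t (diag_path u) = (u == t)%:R.
Proof.
rewrite /gadget_rel /diag_path /level_path !xpair_eqE !eqseq_cons.
by rewrite !eq_diag_low eq_diag eq_out !andbF mulr0 !subr0 eqxx /= !andbT andbb.
Qed.

(** Both conditions on [c] enter here: the coefficients are 1, -c and -1, and the last two add up to
    -c - 1 when the two level paths coincide. *)
Lemma gadget_rel_neq0 q t p : support_spec q t p -> gadget_rel q t p != 0.
Proof.
have neq r u : (level_path r u == diag_path u) = false.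
  by rewrite /diag_path /level_path !xpair_eqE !eqseq_cons eq_sym eq_diag_low andbF.
have cN1 : - c - 1 != 0 by rewrite -opprD oppr_eq0 addrC.
case; first by rewrite gadget_rel_diag eqxx oner_neq0.
  rewrite /gadget_rel eqxx neq sub0r mulr1.
  by case: (_ == level_path _ _); rewrite // subr0 oppr_eq0.
rewrite /gadget_rel eqxx neq sub0r.
by case: (_ == level_path _ _); rewrite ?mulr1 // mulr0 oppr0 sub0r oppr_eq0 oner_neq0.
Qed.

Lemma gadget_rel_path q t p : gadget_rel q t p != 0 ->
  [/\ p.1 = v0, qend p = leaf t, qvalid p & (2 <= size p.2)%N].
Proof.
by case/gadget_rel_support; rewrite /diag_path /level_path !qvalid_cons !qend_cons !endsE !eqxx.
Qed.

Lemma sum_neq0 (I : finType) (F : I -> k) : \sum_t F t != 0 -> exists t, F t != 0.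
Proof.
move=> nz; apply/existsP; rewrite -[[exists _, _]]negbK negb_exists; apply: contra nz.
by move/forallP=> F0; rewrite big1 // => t _; apply/eqP; rewrite -[_ == _]negbK.
Qed.

Lemma gadget_ideal_support q f p : gadget_ideal q f -> f p != 0 ->
  exists t, gadget_rel q t p != 0.
Proof.
case=> C -> /sum_neq0[t nz]; exists t.
by apply: contraNneq nz => ->; rewrite mulr0.
Qed.

(** The path [diag_path t] occurs in the relation of [t] only, with coefficient 1, so the
    coordinates of [f] can be read off there. *)
Lemma gadget_idealE q f : gadget_ideal q f ->
  forall p, f p = \sum_t f (diag_path t) * gadget_rel q t p.
Proof.
case=> C fE p; rewrite fE; apply: eq_bigr => t _; congr (_ * _).
rewrite fE (bigD1 t) //= gadget_rel_diag eqxx mulr1 big1 ?addr0 // => u ut.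
by rewrite gadget_rel_diag eq_sym (negbTE ut) mulr0.
Qed.

Lemma gadget_rel_ideal q t : gadget_ideal q (gadget_rel q t).
Proof.
exists (fun u => (u == t)%:R) => p; rewrite (bigD1 t) //= eqxx mul1r big1 ?addr0 //.
by move=> u /negbTE->; rewrite mul0r.
Qed.

Lemma gadget_is_ideal q : is_ideal (gadget_ideal q).
Proof.
have supp f p : gadget_ideal q f -> f p != 0 ->
    [/\ p.1 = v0, vrank (qend p) = 3, qvalid p & (2 <= size p.2)%N].
  move=> If /(gadget_ideal_support If)[t /gadget_rel_path[? -> ? ?]].
  by rewrite vrank_leaf.
split; first by move=> f If; apply/is_kQE => p /(supp _ _ If)[].
split; first by move=> f g fg [C fE]; exists C => p; rewrite -fg.
split; first by exists (fun=> 0) => p; rewrite big1 // => t _; rewrite mul0r.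
split.
  move=> f g [C fE] [D gE]; exists (fun t => C t + D t) => p.
  by rewrite fE gE -big_split; apply: eq_bigr => t _; rewrite mulrDl.
split.
  move=> a f [C fE]; exists (fun t => a * C t) => p.
  by rewrite fE mulr_sumr; apply: eq_bigr => t _; rewrite mulrA.
move=> f g _ If; have [C fE] := If; split.
  (* All paths in [f] start at the source [v0], so left multiplication by [g] only sees its
     coefficient at the stationary path of [v0]. *)
  exists (fun t => g (v0, [::]) * C t) => p.
  rewrite [RHS](_ : _ = g (v0, [::]) * f p); last first.
    by rewrite fE mulr_sumr; apply: eq_bigr => t _; rewrite mulrA.
  rewrite /mulQ; case: ifP => [|/negbT pv]; last first.
    by have [->|/(supp _ _ If)[_ _ /idPn]] := eqVneq (f p) 0; rewrite ?mulr0.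
  case: p => v s pv; rewrite big_ord_recl big1 ?addr0 => [|i _] /=.
    rewrite take0 drop0 /qend /=.
    by have [->|/(supp _ _ If)[/= ->]] := eqVneq (f (v, s)) 0; rewrite ?mulr0.
  (* A nonempty prefix cannot end at [v0], which has height 0, so every other term of the
     convolution vanishes. *)
  have [->|/(supp _ _ If)[/= ev _ _ _]] :=
    eqVneq (f (qend (v, take (bump 0 i) s), drop (bump 0 i) s)) 0.
    by rewrite mulr0.
  move: pv; rewrite -{1}(cat_take_drop (bump 0 i) s) qvalid_cat.
  case/andP=> /vrank_path; rewrite ev vrank_level inordK // leqn0 addn_eq0.
  by rewrite size_takel ?andbF //= /bump leq0n ltn_ord.
(* Dually, no arrow leaves [leaf t], so right multiplication scales the relation of [t] by the
   coefficient of [g] at the stationary path there. The scalar depends on [t], and distinct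
   relations end at distinct sinks. *)
exists (fun t => C t * g (leaf t, [::])) => p.
transitivity (f p * g (qend p, [::])); last first.
  rewrite fE mulr_suml; apply: eq_bigr => t _; rewrite mulrAC -!mulrA; congr (_ * _).
  have [->|/gadget_rel_path[_ -> _ _] //] := eqVneq (gadget_rel q t p) 0.
  by rewrite !mulr0.
rewrite /mulQ; case: ifP => [|/negbT pv]; last first.
  by have [->|/(supp _ _ If)[_ _ /idPn]] := eqVneq (f p) 0; rewrite ?mul0r.
case: p => v s pv; rewrite big_ord_recr big1 ?add0r => [|i _] /=.
  by rewrite add0r take_size drop_size.
have [->|/(supp _ _ If)[/= _ ev _ _]] := eqVneq (f (v, take i s)) 0; first by rewrite mul0r.
move: pv; rewrite -{1}(cat_take_drop i s) qvalid_cat => /andP[_ /vrank_path].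
rewrite ev size_drop => /leq_trans/(_ (vrank_le _)).
by rewrite -[X in (_ <= X)%N]addn0 leq_add2l leqn0 subn_eq0 leqNgt ltn_ord.
Qed.

Lemma gadget_admissible q : admissible (gadget_ideal q).
Proof.
split; first exact: gadget_is_ideal.
(* There are no paths of length 4, so the fourth power of the arrow ideal is zero. *)
exists 4; split=> //; split=> f.
  case=> /is_kQE f_valid f4; exists (fun=> 0) => -[v s].
  rewrite big1 => [|t _]; last by rewrite mul0r.
  apply/eqP; apply: contraTT isT => nz.
  by have := leq_trans (f4 _ nz) (size_path (f_valid _ nz)).
move=> If; split=> [|p /(gadget_ideal_support If)[t /gadget_rel_path[]] //].
by case: (gadget_is_ideal q) => + _; apply.
Qed.

(** * The automorphism that carries one ideal onto another *)

Definition bump_at (r : 'I_m * 'I_m) (a b : 'I_(narrs Q)) : k :=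
  (a == low r.1)%:R * (b == up r.2)%:R.

Lemma bump_at_neq0 r a b : bump_at r a b != 0 -> a = low r.1 /\ b = up r.2.
Proof.
rewrite /bump_at; have [->|_] := eqVneq a; last by rewrite mul0r eqxx.
by have [->|_] := eqVneq b; rewrite // mulr0 eqxx.
Qed.

(** For r = (x, y), [bump_at r a b] is the coefficient at the path a b of the element x_0 y_1. *)
Lemma bump_at_diff_neq0 r r' a b : bump_at r a b - bump_at r' a b != 0 ->
  exists x y, a = low x /\ b = up y.
Proof.
have [->|/bump_at_neq0[-> ->] _] := eqVneq (bump_at r a b) 0; last by exists r.1, r.2.
by rewrite sub0r oppr_eq0 => /bump_at_neq0[-> ->]; exists r'.1, r'.2.
Qed.

(* The effect on coefficients of the automorphism of the path algebra sending
   [diag t] to [diag t] + c (q t - q' t), [q t] being read as a path. *)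
Definition twist q q' (f : qpath Q -> k) : qpath Q -> k := fun p =>
  f p + (if p.2 is a :: b :: s then
    c * \sum_t (bump_at (q t) a b - bump_at (q' t) a b) * f (p.1, diag t :: s)
  else 0).

Lemma bump_at_notlow r a b : (forall x, a != low x) -> bump_at r a b = 0.
Proof. by move=> /(_ r.1)/negbTE aN; rewrite /bump_at aN mul0r. Qed.

Lemma twist_diag q q' f v t s : twist q q' f (v, diag t :: s) = f (v, diag t :: s).
Proof.
rewrite /twist /=; case: s => [|b s]; rewrite ?addr0 // big1 ?mulr0 ?addr0 // => u _.
by rewrite !bump_at_notlow ?subrr ?mul0r // => x; rewrite eq_diag_low.
Qed.

(** The correction reads only coefficients at paths beginning with a [diag], which [twist] leaves
    alone; exchanging [q] and [q'] changes its sign. *)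
Lemma twistK q q' f p : twist q' q (twist q q' f) p = f p.
Proof.
rewrite {1}/twist; case: p => v [|a [|b s]] /=; rewrite ?addr0 /twist ?addr0 //=.
rewrite -addrA -mulrDr -big_split big1 ?mulr0 ?addr0 // => t _ /=.
by rewrite -/(twist q q' f _) twist_diag -mulrDl addrC subrKA subrr mul0r.
Qed.

(** In a_t - c q_t - z_0 e_1 the added term c (q_t - q'_t) cancels - c q_t and leaves - c q'_t. *)
Lemma twist_rel q q' t p : twist q q' (gadget_rel q t) p = gadget_rel q' t p.
Proof.
case: p => v s0.
have lvl r a b s : ((v, [:: a, b & s]) == level_path r t)%:R
    = bump_at r a b * ((v == v0) && (s == [:: out t]))%:R :> k.
  rewrite /bump_at /level_path xpair_eqE !eqseq_cons -!natrM !mulnb; congr (_%:R).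
  by rewrite andbCA (andbCA (v == v0)) andbA.
have dg u s : gadget_rel q t (v, diag u :: s)
    = (u == t)%:R * ((v == v0) && (s == [:: out t]))%:R.
  rewrite /gadget_rel /level_path /diag_path !xpair_eqE !eqseq_cons !eq_diag_low eq_diag.
  rewrite !andbF mulr0 !subr0 -natrM mulnb; congr (_%:R).
  by rewrite andbCA.
rewrite /twist /=; case: s0 => [|a [|b s]]; rewrite ?addr0.
- by rewrite /gadget_rel !xpair_eqE !andbF.
- by rewrite /gadget_rel !xpair_eqE !eqseq_cons !andbF.
rewrite (bigD1 t) //= big1 ?addr0 => [|u /negbTE ut]; last by rewrite dg ut mul0r mulr0.
rewrite dg eqxx mul1r /gadget_rel !lvl mulrBl mulrBr addrAC addrA; congr (_ - _).
by rewrite subrK.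
Qed.

Lemma twist_kQ q q' f : is_kQ f -> is_kQ (twist q q' f).
Proof.
move=> /is_kQE f_valid; apply/is_kQE => -[v s0].
have [fp|/f_valid //] := eqVneq (f (v, s0)) 0.
rewrite /twist /= fp add0r; case: s0 {fp} => [|a [|b s]]; rewrite ?eqxx //.
rewrite mulf_eq0 (negbTE c_neq0) /= => /sum_neq0[t].
rewrite mulf_eq0 negb_or => /andP[/bump_at_diff_neq0[x [y [-> ->]]] /f_valid].
by rewrite !qvalid_cons !endsE eqxx.
Qed.

Lemma twist_small q q' f p : (size p.2 < 2)%N -> twist q q' f p = f p.
Proof. by case: p => v [|a [|b s]] // _; rewrite /twist /= addr0. Qed.

Lemma twist_not_v0 q q' f v s : qvalid (v, s) -> v != v0 ->
  twist q q' f (v, s) = f (v, s).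
Proof.
case: s => [|a [|b s]]; rewrite /twist /= ?addr0 // qvalid_cons => /andP[/eqP av _] vN.
rewrite big1 ?mulr0 ?addr0 // => t _.
by rewrite !bump_at_notlow ?subrr ?mul0r // => x; apply: contraNneq vN => ax;
  rewrite -av ax src_low.
Qed.

Lemma mulQ_cons (f g : qpath Q -> k) v a s : qvalid (v, a :: s) ->
  mulQ f g (v, a :: s) = f (v, [::]) * g (v, a :: s) +
    \sum_(i < (size s).+1) f (v, a :: take i s) * g (qend (tgt a, take i s), drop i s).
Proof. by move=> asv; rewrite /mulQ asv big_ord_recl. Qed.

Lemma mulQ_cons2 (f g : qpath Q -> k) v a b s : qvalid (v, [:: a, b & s]) ->
  mulQ f g (v, [:: a, b & s]) = f (v, [::]) * g (v, [:: a, b & s]) +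
    (f (v, [:: a]) * g (tgt a, b :: s) +
     \sum_(i < (size s).+1)
        f (v, [:: a, b & take i s]) * g (qend (tgt b, take i s), drop i s)).
Proof. by move/mulQ_cons->; rewrite big_ord_recl. Qed.

Lemma twist_cons2 q q' f v a b s :
  twist q q' f (v, [:: a, b & s]) = f (v, [:: a, b & s]) +
    c * \sum_t (bump_at (q t) a b - bump_at (q' t) a b) * f (v, diag t :: s).
Proof. by []. Qed.

(** A [diag] starts at the source [v0], so it can only be the first arrow of a path. Cutting a path
    therefore leaves the correction to the factor containing its first two arrows, and the cut
    between these two arrows is not affected by it. *)
Lemma twist_mul q q' f g p :
  twist q q' (mulQ f g) p = mulQ (twist q q' f) (twist q q' g) p.
Proof.
(* A nonzero weight forces a b to be parallel to [diag t], so one may replace the other inside a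
   path. *)
have diag_valid v a b s t : bump_at (q t) a b - bump_at (q' t) a b != 0 ->
    qvalid (v, [:: a, b & s]) = qvalid (v, diag t :: s) /\ tgt b = tgt (diag t).
  by move=> /bump_at_diff_neq0[x [y [-> ->]]]; rewrite !qvalid_cons !endsE eqxx.
have [pv|pN] := boolP (qvalid p); last first.
  rewrite {2}/mulQ (negbTE pN) /twist {1}/mulQ (negbTE pN) add0r.
  case: p pN => v [|a [|b s]] //= pN; rewrite big1 ?mulr0 // => t _.
  have [->|/diag_valid] := eqVneq (bump_at (q t) a b - bump_at (q' t) a b) 0.
    by rewrite mul0r.
  by move=> /(_ v s)[Ev _]; rewrite /mulQ -Ev (negbTE pN) mulr0.
have [p2|p2] := ltnP (size p.2) 2.
  rewrite twist_small // /mulQ pv; apply: eq_bigr => i _.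
  by rewrite !twist_small //= ?size_drop ?size_take_min;
    [apply: leq_ltn_trans (leq_subr _ _) _ | apply: leq_ltn_trans (geq_minr _ _) _].
case: p pv p2 => v [|a [|b s]] // pv _.
have [av bsv] : src a = v /\ qvalid (tgt a, b :: s).
  by move: pv; rewrite qvalid_cons => /andP[/eqP].
have [ba sv] : src b = tgt a /\ qvalid (tgt b, s).
  by move: bsv; rewrite qvalid_cons => /andP[/eqP].
have v0N (w : 'I_(nverts Q)) : (0 < vrank w)%N -> w != v0.
  by apply: contraTneq => ->; rewrite vrank_level inordK.
rewrite twist_cons2 !mulQ_cons2 // twist_small // (@twist_small _ _ f (v, [:: a])) //.
rewrite (twist_not_v0 _ _ _ bsv); last first.
  exact/v0N/(leq_ltn_trans (leq0n _) (vrank_arrow a)).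
have twist_tail (i : 'I_(size s).+1) :
    twist q q' g (qend (tgt b, take i s), drop i s) = g (qend (tgt b, take i s), drop i s).
  move: sv; rewrite -{1}(cat_take_drop i s) qvalid_cat => /andP[tv dv].
  apply: (twist_not_v0 _ _ _ dv); apply: v0N; apply: leq_trans (vrank_path tv).
  by rewrite addn_gt0 (leq_ltn_trans (leq0n _) (vrank_arrow b)).
under [in RHS]eq_bigr do rewrite twist_tail twist_cons2 mulrDl.
rewrite big_split /= !twist_cons2 mulrDr -!addrA; congr (_ + _).
rewrite [RHS]addrCA; congr (_ + _); rewrite [RHS]addrCA; congr (_ + _).
under [in RHS]eq_bigr do rewrite -mulrA.
rewrite -mulr_sumr mulrCA -mulrDr; congr (_ * _).
under [X in _ = _ + X]eq_bigr do rewrite mulr_suml.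
rewrite exchange_big mulr_sumr -big_split; apply: eq_bigr => t _ /=.
have [->|/diag_valid] := eqVneq (bump_at (q t) a b - bump_at (q' t) a b) 0.
  by rewrite !mul0r mulr0 add0r big1 // => i _; rewrite !mul0r.
case/(_ v s) => vE bE; rewrite mulQ_cons -?vE // mulrDr mulrCA; congr (_ + _).
by rewrite mulr_sumr; apply: eq_bigr => i _; rewrite -bE mulrA.
Qed.

(** [twist q q'] is an automorphism of the path algebra itself, with inverse [twist q' q]; the
    congruences required modulo the ideal are thus equalities, and the differences are the zero
    function. *)
Lemma gadget_alg_iso q q' : alg_iso (gadget_ideal q) (gadget_ideal q').
Proof.
have twist_ideal r r' f : gadget_ideal r f -> gadget_ideal r' (twist r r' f).
  case=> C fE; exists C => p.
  transitivity (\sum_t C t * twist r r' (gadget_rel r t) p); last first.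
    by apply: eq_bigr => t _; rewrite twist_rel.
  rewrite /twist; case: p => v [|a [|b s]] /=.
  - by rewrite fE addr0; apply: eq_bigr => t _; rewrite addr0.
  - by rewrite fE addr0; apply: eq_bigr => t _; rewrite addr0.
  rewrite fE.
  under [RHS]eq_bigr do rewrite mulrDr mulrCA.
  rewrite big_split -mulr_sumr /=; congr (_ + c * _).
  under [RHS]eq_bigr do rewrite mulr_sumr.
  rewrite exchange_big; apply: eq_bigr => u _ /=.
  by rewrite fE mulr_sumr; apply: eq_bigr => t _; rewrite mulrCA.
have zero r : gadget_ideal r (fun=> 0) by case: (gadget_is_ideal r) => _ [_ []].
have ext r f g : (forall p, f p = g p) -> gadget_ideal r f -> gadget_ideal r g.
  by case: (gadget_is_ideal r) => _ [+ _]; apply.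
exists (twist q q').
split; first by move=> f; apply: twist_kQ.
split.
  move=> f g _ _ [v [|a [|b s]]]; rewrite /twist /= ?addr0 // addrACA -mulrDr.
  by rewrite -big_split; congr (_ + c * _); apply: eq_bigr => t _; rewrite mulrDr.
split.
  move=> a f _ [v [|a' [|b s]]]; rewrite /twist /= ?addr0 // mulrDr; congr (_ + _).
  by rewrite mulrCA; congr (_ * _); rewrite mulr_sumr; apply: eq_bigr => t _; rewrite mulrCA.
split.
  move=> f _; split; last exact: twist_ideal.
  by move/(twist_ideal _ q); apply: ext => p; rewrite twistK.
split.
  by move=> f g _ _; apply: ext (zero q') => p; rewrite twist_mul subrr.
split.
  apply: ext (zero q') => -[v [|a [|b s]]]; rewrite /twist /oneQ /= ?addr0 ?subrr //.
  by rewrite big1 ?mulr0 ?addr0 ?subrr // => t _; rewrite mulr0.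
move=> g g_kQ; exists (twist q' q g); split; first exact: twist_kQ.
by apply: ext (zero q') => p; rewrite twistK subrr.
Qed.

Lemma gadget_rel_minimal q t : minimal_rel (gadget_ideal q) (gadget_rel q t).
Proof.
split; first exact: gadget_rel_ideal.
split; first by exists v0, (leaf t) => p /gadget_rel_path[].
split.
  exists (diag_path t), (level_path (q t) t); split.
    by move=> [/eqP]; rewrite eq_diag_low.
  by split; apply: gadget_rel_neq0; constructor.
move=> P [p [p_neq0 Pp]] [p' [p'_neq0 Pp']] /gadget_idealE IP.
(* The truncation vanishes at the diagonal paths of all other triples, so membership in the ideal
   makes it zero or the whole relation. *)
have {IP} E p1 : (if P p1 then gadget_rel q t p1 else 0)
    = (P (diag_path t))%:R * gadget_rel q t p1.
  rewrite IP (bigD1 t) //= big1 ?addr0 => [|u /negbTE ut].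
    by rewrite gadget_rel_diag eqxx; case: ifP.
  by rewrite gadget_rel_diag ut; case: ifP; rewrite mul0r.
have := E p; have := E p'; rewrite Pp (negbTE Pp').
case: (P _) => /esym/eqP; first by rewrite mul1r (negbTE p'_neq0).
by move=> _ /eqP; rewrite mul0r (negbTE p_neq0).
Qed.

Lemma homot_gadget q t p p' : support_spec q t p -> support_spec q t p' ->
  homot (gadget_ideal q) (path_walk p) (path_walk p').
Proof.
move=> /gadget_rel_neq0 pt /gadget_rel_neq0 pt'.
exact: h_rel (gadget_rel_minimal q t) pt pt'.
Qed.

(** * The fundamental group *)

Section FundamentalGroup.
Variable T : 'I_m -> 'I_m -> 'I_m -> bool.
Hypothesis T_unit : forall z, T e z z.

Definition table_choice (t : triple) : 'I_m * 'I_m :=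
  if T t.1.1 t.1.2 t.2 then t.1 else (t.2, e).

Local Notation TP := (table_presentation e T).
Local Notation I := (gadget_ideal table_choice).
Local Notation pos a := ((a, true) : letter Q).
Local Notation neg a := ((a, false) : letter Q).

(** The tree arrows e_0 and e_1 get the letter e, which is trivial in the group, and a_t gets the
    product z that the relation of t assigns to it. *)
Definition arrow_label (a : 'I_(narrs Q)) : word TP :=
  match enum_val a : arr with
  | inl (inl (inl x)) | inl (inl (inr x)) => [:: (x, true)]
  | inl (inr t) => [:: (t.2, true)]
  | inr _ => [::]
  end.

Lemma arrow_labelE :
  ((forall x, arrow_label (low x) = [:: (x, true)]) *
   (forall x, arrow_label (up x) = [:: (x, true)]) *
   (forall t, arrow_label (diag t) = [:: (t.2, true)]) *
   (forall t, arrow_label (out t) = [::]))%type.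
Proof. by rewrite /arrow_label; do !split=> *; rewrite enum_rankK. Qed.

Definition letter_label (l : letter Q) : word TP :=
  if l.2 then arrow_label l.1 else winv (arrow_label l.1).
Definition label (s : seq (letter Q)) : word TP := flatten (map letter_label s).

Lemma label_cat s s' : label (s ++ s') = label s ++ label s'.
Proof. by rewrite /label map_cat flatten_cat. Qed.

Lemma label_winv s : label (winv s) = winv (label s).
Proof.
elim: s => [|l s IH] //; rewrite winv_cons label_cat IH.
rewrite -(cat1s l s) label_cat winv_cat /label /= !cats0; congr (_ ++ _).
by case: l => a []; rewrite /letter_label //= winvK.
Qed.

Lemma label_homot w w' : homot I w w' -> wequiv (label w.2) (label w'.2).
Proof.
elim=> {w w'}.
- by move=> w; apply: we_refl.
- by move=> w w' _; apply: we_sym.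
- by move=> w w' w'' _ ww' _; apply: we_trans.
- by move=> a; rewrite /label /= cats0; apply: wequiv_winvr.
- by move=> a; rewrite /label /= cats0; apply: wequiv_winvl.
- move=> f p p' [If [[x [y endsf]] _]] fp fp'.
  have [t tp] := gadget_ideal_support If fp.
  have [t' tp'] := gadget_ideal_support If fp'.
  (* The paths of a minimal relation share their end vertex, and this sink determines the triple. *)
  have Et : t' = t.
    have [_ ep] := endsf _ fp; have [_ ep'] := endsf _ fp'.
    have [_ lp _ _] := gadget_rel_path tp; have [_ lp' _ _] := gadget_rel_path tp'.
    suff [] : (inr t' : vert) = inr t by [].
    by apply: enum_rank_inj; rewrite -/(leaf t') -/(leaf t) -lp -lp' ep ep'.
  rewrite {t'}Et in tp'.
  have lab p1 : gadget_rel table_choice t p1 != 0 ->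
      wequiv (label (path_walk p1).2) [:: (t.2, true)].
    case/gadget_rel_support; rewrite /label /letter_label /= !arrow_labelE /=.
    - exact: we_refl.
    - rewrite /table_choice; case: ifP => [/table_rel //|_]; exact: table_mulr1.
    exact: table_mulr1.
  exact: we_trans (lab _ tp) (we_sym (lab _ tp')).
move=> w u v w' _ uv *; rewrite /= !label_cat; exact: we_ctx.
Qed.

(** * Normal forms of walks with respect to the spanning tree *)

Local Notation hom := (homotopic I).
Local Notation between := (@walk_between Q).

Definition tree_walk (v : 'I_(nverts Q)) : seq (letter Q) :=
  match enum_val v : vert with
  | inl j => take j [:: pos (low e); pos (up e)]
  | inr t => [:: pos (low e); pos (up e); pos (out t)]
  end.

Lemma tree_walkE :
  ((tree_walk v0 = [::]) * (tree_walk v1 = [:: pos (low e)]) *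
   (tree_walk v2 = [:: pos (low e); pos (up e)]) *
   (forall t, tree_walk (leaf t) = [:: pos (low e); pos (up e); pos (out t)]))%type.
Proof. by rewrite /tree_walk; do !split=> *; rewrite enum_rankK ?inordK. Qed.

Lemma between_pos x y a : between x y [:: pos a] = (src a == x) && (tgt a == y).
Proof. by rewrite walk_cons walk_nil. Qed.

Lemma between_low x : between v0 v1 [:: pos (low x)].
Proof. by rewrite between_pos !endsE !eqxx. Qed.
Lemma between_up x : between v1 v2 [:: pos (up x)].
Proof. by rewrite between_pos !endsE !eqxx. Qed.
Lemma between_level x y : between v0 v2 [:: pos (low x); pos (up y)].
Proof. exact: walk_cat (between_low x) (between_up y). Qed.
Lemma between_diag t : between v0 v2 [:: pos (diag t)].
Proof. by rewrite between_pos !endsE !eqxx. Qed.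
Lemma between_out t : between v2 (leaf t) [:: pos (out t)].
Proof. by rewrite between_pos !endsE !eqxx. Qed.

Lemma tree_walkP v : between v0 v (tree_walk v).
Proof.
elim/vertex_ind: v => [|||t]; rewrite tree_walkE.
- by rewrite walk_nil.
- exact: between_low.
- exact: between_level.
exact: walk_cat (between_level e e) (between_out t).
Qed.

(** The generator x is realised by the loop x_0 e_0^-1 at [v0]. *)
Definition gen_loop (l : 'I_m * bool) : seq (letter Q) :=
  let s := [:: pos (low l.1); neg (low e)] in if l.2 then s else winv s.
Definition loop (u : word TP) : seq (letter Q) := flatten (map gen_loop u).

Lemma loop_cat u v : loop (u ++ v) = loop u ++ loop v.
Proof. by rewrite /loop map_cat flatten_cat. Qed.

Lemma loop_winv u : loop (winv u) = winv (loop u).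
Proof.
elim: u => [|l u IH] //; rewrite winv_cons loop_cat IH.
by rewrite -(cat1s l u) loop_cat winv_cat /loop /= !cats0; case: l => a [].
Qed.

Lemma gen_loopP l : between v0 v0 (gen_loop l).
Proof.
have K x : between v0 v0 (gen_loop (x, true)).
  exact: walk_cat (between_low x) (walk_winv (between_low e)).
by case: l => x []; [apply: K | apply: walk_winv (K x)].
Qed.

Lemma loopP u : between v0 v0 (loop u).
Proof.
elim: u => [|l u IH]; first by rewrite walk_nil.
exact: walk_cat (gen_loopP l) IH.
Qed.

Lemma homotopic_table x y z : T x y z ->
  hom v0 v2 [:: pos (low x); pos (up y)] [:: pos (low z); pos (up e)].
Proof.
move=> Txyz; have ob := between_out (x, y, z).
apply: (homotopic_cancelr ob); try exact: between_level.
split; try exact: walk_cat (between_level _ _) ob.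
have := @homot_gadget table_choice (x, y, z) _ _
  (SupportRel _ _) (SupportBase _ _).
by rewrite {1}/level_path (_ : table_choice (x, y, z) = (x, y)) // /table_choice /= Txyz.
Qed.

Lemma homotopic_diag t :
  hom v0 v2 [:: pos (diag t)] [:: pos (low t.2); pos (up e)].
Proof.
have ob := between_out t.
apply: (homotopic_cancelr ob); [exact: between_diag | exact: between_level | ].
split; [exact: walk_cat (between_diag _) ob | exact: walk_cat (between_level _ _) ob | ].
exact: (homot_gadget (SupportDiag _ t) (SupportBase _ t)).
Qed.

Lemma loop_low x : hom v0 v1 [:: pos (low x)] (loop [:: (x, true)] ++ [:: pos (low e)]).
Proof.
apply: homotopic_sym; rewrite -[X in hom _ _ _ X]cats0.
exact: homotopic_catl (between_low x) (homotopic_winvl I (between_low e)).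
Qed.

Lemma loop_level x : hom v0 v2 [:: pos (low x); pos (up e)]
  (loop [:: (x, true)] ++ [:: pos (low e); pos (up e)]).
Proof. exact: homotopic_catr (between_up e) (loop_low x). Qed.

(** After multiplying by e_0 e_1, the loop of y turns into y_0 e_1, which the triple (e, y, y) moves
    to e_0 y_1. The loop of x then absorbs e_0 and gives x_0 y_1, homotopic to z_0 e_1 by the triple
    (x, y, z). *)
Lemma loop_table x y z : T x y z ->
  hom v0 v0 (loop [:: (x, true); (y, true)]) (loop [:: (z, true)]).
Proof.
move=> Txyz; apply: (homotopic_cancelr (between_level e e)); try exact: loopP.
apply: homotopic_trans _ (loop_level z).
apply: homotopic_trans _ (homotopic_table Txyz).
rewrite (loop_cat [:: (x, true)] [:: (y, true)]) -catA.
apply: (homotopic_trans (t := loop [:: (x, true)] ++ [:: pos (low e); pos (up y)])).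
  apply: homotopic_catl (loopP _) _; apply: homotopic_sym.
  exact: homotopic_trans (homotopic_table (T_unit y)) (loop_level y).
exact: homotopic_catr (between_up y) (homotopic_sym (loop_low x)).
Qed.

Lemma loop_equiv u v : wequiv u v -> hom v0 v0 (loop u) (loop v).
Proof.
elim=> {u v}.
- by move=> u; apply/homotopic_refl/loopP.
- by move=> u v _; apply: homotopic_sym.
- by move=> u v w _ uv _; apply: homotopic_trans.
- move=> x b; have := homotopic_winvr I (gen_loopP (x, b)).
  by rewrite /loop /= cats0; case: b => /=; rewrite ?winvK.
- apply: table_ind => [|x y z Txyz].
    by have := homotopic_winvr I (between_low e).
  rewrite (loop_cat [:: (x, true); (y, true)] [:: (z, false)]).
  apply: homotopic_trans (homotopic_catr (loopP _) (loop_table Txyz)) _.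
  have := homotopic_winvr I (loopP [:: (z, true)]); by rewrite -loop_winv.
move=> s u v t _ uv; rewrite !loop_cat.
exact: homotopic_catl (loopP _) (homotopic_catr (loopP _) uv).
Qed.

(** Only upper arrows need an idea: by the triple (e, x, x), e_0 x_1 is homotopic to x_0 e_1, so x_0
    and x_1 yield the same loop. *)
Lemma arrow_normal a : hom (src a) (tgt a) [:: pos a]
  (winv (tree_walk (src a)) ++ loop (arrow_label a) ++ tree_walk (tgt a)).
Proof.
case/arrowP: a => [x|x|t|t]; rewrite arrow_labelE !endsE !tree_walkE.
- exact: loop_low.
- apply: homotopic_trans (homotopic_catl (walk_winv (between_low e))
    (homotopic_trans (homotopic_table (T_unit x)) (loop_level x))).
  apply: homotopic_sym.
  exact: homotopic_catr (between_up x) (homotopic_winvl I (between_low e)).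
- exact: homotopic_trans (homotopic_diag t) (loop_level t.2).
apply: homotopic_sym.
exact: homotopic_catr (between_out t) (homotopic_winvl I (between_level e e)).
Qed.

Lemma letter_normal l : hom (lsrc l) (ltgt l) [:: l]
  (winv (tree_walk (lsrc l)) ++ loop (letter_label l) ++ tree_walk (ltgt l)).
Proof.
case: l => a [] /=; first exact: arrow_normal.
have := homotopic_winv (arrow_normal a).
by rewrite !winv_cat winvK -catA -loop_winv.
Qed.

(** The normal forms of consecutive letters are concatenated, and the tree walks meeting in between
    cancel. Hence a walk is determined up to homotopy by its ends and its label. *)
Lemma walk_normal x y s : between x y s ->
  hom x y s (winv (tree_walk x) ++ loop (label s) ++ tree_walk y).
Proof.
elim: s x => [|l s IH] x.
  rewrite walk_nil => /eqP->; apply: homotopic_sym.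
  exact: homotopic_winvl (tree_walkP y).
rewrite walk_cons => /andP[/eqP<- /IH sn].
apply: homotopic_trans (homotopic_cat (letter_normal l) sn) _.
rewrite -(cat1s l s) label_cat (_ : label [:: l] = letter_label l); last exact: cats0.
rewrite loop_cat -!catA.
apply: homotopic_catl (walk_winv (tree_walkP _)) _.
apply: homotopic_catl (loopP _) _.
rewrite catA; apply: (homotopic_catr (s' := [::])).
  exact: walk_cat (loopP _) (tree_walkP y).
exact: homotopic_winvr (tree_walkP _).
Qed.

Lemma label_tree v : wequiv (label (tree_walk v)) [::].
Proof.
have ee : @wequiv TP [:: (e, true); (e, true)] [::].
  exact: we_trans (table_mulr1 _ _ _) (table_unit _ _).
elim/vertex_ind: v => [|||t]; rewrite tree_walkE /label /letter_label /= ?arrow_labelE.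
- exact: we_refl.
- exact: table_unit.
- exact: ee.
exact: ee.
Qed.

Lemma label_loop u : wequiv (label (loop u)) u.
Proof.
elim: u => [|l u IH]; first exact: we_refl.
rewrite -cat1s loop_cat label_cat; apply: wequiv_cat IH.
have K x : wequiv (label (loop [:: (x, true)])) [:: (x, true)].
  rewrite /label /letter_label /= !arrow_labelE /=.
  apply: (@wequiv_cat TP [:: (x, true)] _ [:: (e, false)] [::] (we_refl _)).
  exact: wequiv_winv (table_unit e T).
case: l => x []; first exact: K.
by have := wequiv_winv (K x); rewrite -label_winv -loop_winv.
Qed.

(** Reading labels is well defined by [label_homot] and injective by [walk_normal]; it is onto
    because a loop at [v0], conjugated by the tree walk to [v], keeps its label up to
    equivalence. *)
Lemma gadget_pi1 (G : AbsGroup) v : presents TP G -> pi1_iso I v G.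
Proof.
case=> phi [phiE [phi_onto phiM]]; exists (fun w => phi (label w.2)).
have closed w : closed_at v w -> w.1 = v /\ between v v w.2.
  by case: w => x s /and3P[wv /= /eqP xv we]; rewrite -xv in we *; split; rewrite ?/between ?wv.
split; [|split].
- move=> [x s] [x' s'] /closed[/= -> s_ok] /closed[/= -> s'_ok]; split.
    by move/label_homot/phiE.
  move/phiE/loop_equiv => ss'.
  have [_ _ h] := walk_normal s_ok; have [_ _ h'] := walk_normal s'_ok.
  apply: h_trans h (h_trans _ (h_sym h')).
  have [] // := homotopic_catl (walk_winv (tree_walkP v))
    (homotopic_catr (tree_walkP v) ss').
- move=> g; have [u <-] := phi_onto g.
  exists (v, winv (tree_walk v) ++ loop u ++ tree_walk v); split.
    have := walk_cat (walk_winv (tree_walkP v)) (walk_cat (loopP u) (tree_walkP v)).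
    by rewrite /closed_at /= eqxx.
  apply/phiE; rewrite /= !label_cat label_winv.
  have := wequiv_cat (wequiv_winv (label_tree v))
    (wequiv_cat (label_loop u) (label_tree v)).
  by rewrite cats0.
by move=> w w' _ _; rewrite /= label_cat phiM.
Qed.

End FundamentalGroup.

End Ideal.
End Gadget.

Theorem theorem1 (k : closedFieldType) (n : nat) (G : 'I_n -> AbsGroup)
  (hG : forall i, finitely_presented (G i)) :
  exists (Qh : quiver) (I : 'I_n -> (qpath Qh -> k) -> Prop),
    qconnected Qh /\ acyclic Qh /\
    (forall i, admissible (I i)) /\
    (forall i j, alg_iso (I i) (I j)) /\
    (forall i (v0 : 'I_(nverts Qh)), pi1_iso (I i) v0 (G i)).
Proof.
have [m [e [T [T_unit presT]]]] := common_table hG.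
have [c cE] : exists c : k, c * c + c + 1 = 0.
  (* With all lower coefficients equal to -1 the root satisfies c^2 = -1 - c. This works in every
     characteristic, whereas c = 1 would fail in characteristic 2. *)
  have [c cE] := @solve_monicpoly k 2 (fun=> -1) isT.
  exists c; move: cE; rewrite !big_ord_recl big_ord0 expr2 => ->.
  by rewrite expr0 expr1 !mulN1r addr0 subrK addNr.
have c_neq0 : c != 0.
  by apply: contra_eq_neq cE => ->; rewrite mul0r !add0r oner_neq0.
have c_neqN1 : 1 + c != 0.
  apply: contra_eq_neq cE => cN; rewrite -{3}(mulr1 c) -mulrDr [c + 1]addrC cN.
  by rewrite mulr0 add0r oner_neq0.
exists (gadget_quiver m), (fun i => gadget_ideal c e (table_choice e (T i))).
split; first exact: gadget_connected.
split; first exact: gadget_acyclic.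
split; first by move=> i; apply: gadget_admissible.
split; first by move=> i j; apply: gadget_alg_iso.
by move=> i v0; apply: gadget_pi1.
Qed.
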